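(* Let $(p_j)_{j\in\mathbb{Z}}$ be real numbers with $0<p_j\le 1/2$ for all $j\in\mathbb{Z}$ and $\inf_{j\in\mathbb{Z}}p_j<1/2$, and let $\{\mathbf{C}(N);\ N=0,1,2,\ldots\}$ be the anisotropic random walk on $\mathbb{Z}^2$ with parameters $(p_j)_{j\in\mathbb{Z}}$, started at $\mathbf{C}(0)=(0,0)$. If $$\sum_{k=0}^{\infty}\left(\sum_{j=-k}^{k}\frac{1}{p_j}\right)^{-1}=\infty,$$ then the walk $\mathbf{C}(\cdot)$ is recurrent.
   Context: The anisotropic random walk with parameters $(p_j)_{j\in\mathbb{Z}}$ is the time-homogeneous Markov chain $\{\mathbf{C}(N)=(C_1(N),C_2(N));\ N=0,1,2,\ldots\}$ on $\mathbb{Z}^2$ with transition probabilities, for all $(k,j)\in\mathbb{Z}^2$ and $N\ge 0$, $$\mathbf{P}(\mathbf{C}(N+1)=(k+1,j)\mid\mathbf{C}(N)=(k,j))=\mathbf{P}(\mathbf{C}(N+1)=(k-1,j)\mid\mathbf{C}(N)=(k,j))=\tfrac12-p_j,$$ $$\mathbf{P}(\mathbf{C}(N+1)=(k,j+1)\mid\mathbf{C}(N)=(k,j))=\mathbf{P}(\mathbf{C}(N+1)=(k,j-1)\mid\mathbf{C}(N)=(k,j))=p_j.$$ Recurrent means that, with probability 1, the walk started at the origin returns to the origin infinitely often. *)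

(* Defs.v *)
From HB Require Import structures.
From mathcomp Require Import all_boot all_order all_algebra.
From mathcomp Require Import all_classical all_reals all_analysis.

Set Implicit Arguments.
Unset Strict Implicit.
Unset Printing Implicit Defensive.

Import Order.TTheory GRing.Theory Num.Theory.

Local Open Scope classical_set_scope.
Local Open Scope ring_scope.

HB.instance Definition _ := isPointed.Build int 0.

(* The discrete sigma-algebra on int, as the library does for nat; int * int
   then carries the product sigma-algebra, which is again the discrete one. *)
HB.instance Definition _ := @isMeasurable.Build default_measure_display
  int discrete_measurable discrete_measurable0
  discrete_measurableC discrete_measurableU.

(* P(A | B); only meaningful when P B != 0. *)
Definition cond_prob (d : measure_display) (T : measurableType d)
    (R : realType) (P : probability T R) (A B : set T) : R :=
  fine (P (A `&` B)) / fine (P B).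

Definition markov_chain (d : measure_display) (T : measurableType d)
    (R : realType) (P : probability T R)
    (d' : measure_display) (S : measurableType d')
    (X : nat -> {RV P >-> S}) : Prop :=
  forall (N : nat) (x : nat -> S) (y : S),
    let past := [set w | forall n, (n <= N)%N -> X n w = x n] in
    P past != 0%E ->
    cond_prob P [set w | X N.+1 w = y] past
    = cond_prob P [set w | X N.+1 w = y] [set w | X N w = x N].

(* The four probabilities sum to 1, so all other transitions have
   probability 0. *)
Definition anisotropic_walk (d : measure_display) (T : measurableType d)
    (R : realType) (P : probability T R) (p : int -> R)
    (C : nat -> {RV P >-> (int * int)%type}) : Prop :=
  markov_chain C /\
  forall (N : nat) (k j : int),
    let step z := cond_prob P [set w | C N.+1 w = z] [set w | C N w = (k, j)] in
    P [set w | C N w = (k, j)] != 0%E ->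
    [/\ step (k + 1, j) = 2^-1 - p j,
        step (k - 1, j) = 2^-1 - p j,
        step (k, j + 1) = p j
      & step (k, j - 1) = p j].

Definition recurrent (d : measure_display) (T : measurableType d)
    (R : realType) (P : probability T R)
    (C : nat -> {RV P >-> (int * int)%type}) : Prop :=
  P (lim_sup_set (fun N => [set w | C N w = (0, 0)])) = 1%E.

(* Main.v *)
(* The walk is reversible for the measure 1 / p_j: it is the random walk on an
   electrical network whose vertical edges have conductance 1 and whose
   horizontal edges in row j have conductance (1/2 - p_j) / p_j.  The edges
   leaving the box [-k, k]^2 have total conductance sum_{|j| <= k} 1 / p_j, so
   the hypothesis is the divergence of the Nash-Williams series.  It yields
   finitely supported functions phi, with phi(0) = 1, of arbitrarily small
   Dirichlet energy.

   Let f(x) be the probability that the walk from x never visits 0.  Then f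
   vanishes at 0 and is harmonic elsewhere.  Testing harmonicity against
   phi^2 f gives E(phi f) <= E(phi), so the edges at 0 force the average of f
   over the neighbours of 0, the escape probability, to vanish.

   By the Markov property, given any finite trajectory ending at 0 the walk
   almost surely returns to 0.  There are countably many such trajectories, so
   almost surely no visit to 0 is the last one. *)

Require Import Defs.
From mathcomp Require Import all_boot all_order all_algebra.
From mathcomp Require Import ring lra zify.
From mathcomp Require Import all_classical all_reals all_analysis.

Set Implicit Arguments.
Unset Strict Implicit.
Unset Printing Implicit Defensive.

Import Order.TTheory GRing.Theory Num.Theory.

Local Open Scope classical_set_scope.
Local Open Scope ring_scope.

(** * Sums over symmetric intervals of integers *)

Section SymmetricSums.
Variable R : realFieldType.
Implicit Types (F G u v : int -> R) (h d : nat -> R) (M : nat).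

(* The sum of [F j] over the integers [- M <= j < M]. *)
Definition symsum M F : R := \sum_(k < M) (F k%:Z + F (- k.+1%:Z)).

Lemma symsum0 F : symsum 0 F = 0.
Proof. by rewrite /symsum big_ord0. Qed.

Lemma symsumS M F : symsum M.+1 F = symsum M F + (F M%:Z + F (- M.+1%:Z)).
Proof. by rewrite /symsum big_ord_recr. Qed.

Lemma eq_symsum M F G : F =1 G -> symsum M F = symsum M G.
Proof. by move=> FG; apply: eq_bigr => k _; rewrite !FG. Qed.

Lemma symsumD M F G :
  symsum M (fun i => F i + G i) = symsum M F + symsum M G.
Proof. by rewrite -big_split; apply: eq_bigr => k _ /=; ring. Qed.

Lemma symsumZ M a F : symsum M (fun i => a * F i) = a * symsum M F.
Proof. by rewrite mulr_sumr; apply: eq_bigr => k _; ring. Qed.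

Lemma symsum_eq0 M F : (forall i, F i = 0) -> symsum M F = 0.
Proof. by move=> F0; apply: big1 => k _; rewrite !F0 addr0. Qed.

Lemma ler_symsum M F G : (forall i, F i <= G i) -> symsum M F <= symsum M G.
Proof. by move=> FG; apply: ler_sum => k _; apply: lerD. Qed.

Lemma symsum_ge0 M F : (forall i, 0 <= F i) -> 0 <= symsum M F.
Proof. by move=> F0; apply: sumr_ge0 => k _; apply: addr_ge0. Qed.

Lemma ler_symsum_term M F i : (forall i, 0 <= F i) ->
  (- M%:Z <= i < M%:Z) -> F i <= symsum M F.
Proof.
move=> F0 iM.
have [i0|i0] := lerP 0 i.
  have kM : (`|i|%N < M)%N by lia.
  rewrite /symsum (bigD1 (Ordinal kM)) //= -addrA.
  have -> : (`|i|%N)%:Z = i by lia.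
  by rewrite lerDl addr_ge0 // sumr_ge0 // => k _; rewrite addr_ge0.
have kM : (`|i|.-1%N < M)%N by lia.
rewrite /symsum (bigD1 (Ordinal kM)) //=.
have -> : - (`|i|.-1.+1%N)%:Z = i by lia.
rewrite [X in X + _]addrC -addrA lerDl addr_ge0 // sumr_ge0 // => k _.
by rewrite addr_ge0.
Qed.

Lemma exchange_symsum M (F : int -> int -> R) :
  symsum M (fun i => symsum M (F i)) = symsum M (fun j => symsum M (F ^~ j)).
Proof.
rewrite /symsum; under eq_bigr do rewrite -big_split /=.
rewrite exchange_big /=; apply: eq_bigr => k _.
by rewrite -big_split; apply: eq_bigr => l _ /=; ring.
Qed.

Lemma symsum_telescope M G :
  symsum M (fun i => G i - G (i + 1)) = G (- M%:Z) - G M%:Z.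
Proof.
elim: M => [|M IH]; first by rewrite symsum0 oppr0 subrr.
rewrite symsumS IH.
have -> : - M.+1%:Z + 1 = - M%:Z by lia.
have -> : M%:Z + 1 = M.+1%:Z by lia.
ring.
Qed.

(** The two summands differ by a telescoping term, whose boundary values vanish with [v]. *)
Lemma symsum_by_parts M u v : v (- M%:Z) = 0 -> v M%:Z = 0 ->
  symsum M (fun i => v i * (2 * u i - u (i + 1) - u (i - 1))) =
  symsum M (fun i => (u (i + 1) - u i) * (v (i + 1) - v i)).
Proof.
move=> v0 v1; pose G i := (u i - u (i - 1)) * v i.
have := symsum_telescope M G.
rewrite /G v0 v1 !mulr0 subrr => G0.
rewrite -[RHS]addr0 -G0 -symsumD; apply: eq_symsum => i.
by rewrite addrK; ring.
Qed.

Lemma sum_centered k F :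
  \sum_(i < k.*2.+1) F (i%:Z - k%:Z) = symsum k F + F k%:Z.
Proof.
elim: k => [|k IH].
  by rewrite symsum0 big_ord_recl big_ord0 addr0 [RHS]add0r.
rewrite doubleS big_ord_recl big_ord_recr /=.
have -> : \sum_(i < k.*2.+1) F ((bump 0 i)%:Z - k.+1%:Z)
          = \sum_(i < k.*2.+1) F (i%:Z - k%:Z).
  by apply: eq_bigr => i _; congr F; rewrite /bump; lia.
rewrite IH symsumS.
have -> : 0%:Z - k.+1%:Z = - k.+1%:Z by lia.
have -> : (bump 0 k.*2.+1)%:Z - k.+1%:Z = k.+1%:Z by rewrite /bump; lia.
ring.
Qed.

(** On a line at distance [m] from the parallel axis, the sup-norm radius stays at [m] until |i|
    exceeds [m]; from there on, each step between radii k and k + 1 occurs once on either side. *)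
Lemma symsum_radial_increment M m h :
  symsum M (fun i => (h (maxn `|(i + 1)%R| m) - h (maxn `|i| m)) ^+ 2) =
  2 * \sum_(k < M | (m <= k)%N) (h k - h k.+1) ^+ 2.
Proof.
rewrite big_mkcond mulr_sumr; apply: eq_bigr => k _.
have -> : `|(k%:Z + 1)%R|%N = k.+1 by lia.
have -> : `|(- k.+1%:Z + 1)%R|%N = k by lia.
have -> : `|(- k.+1%:Z)%R|%N = k.+1 by lia.
rewrite absz_nat; case: leqP => mk.
  by rewrite (maxn_idPl (leqW mk)); ring.
by rewrite (maxn_idPr mk); ring.
Qed.

(** Both sides sum over the pairs with |j| <= k < M; the index j = -M, which [symsum] includes, has
    an empty inner sum. *)
Lemma symsum_layers M F d :
  symsum M (fun j => F j * \sum_(k < M | (`|j| <= k)%N) d k) =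
  \sum_(k < M) d k * (\sum_(i < k.*2.+1) F (i%:Z - k%:Z)).
Proof.
rewrite /symsum.
transitivity (\sum_(l < M) \sum_(k < M)
   d k * ((if (l <= k)%N then F l%:Z else 0) +
          (if (l < k)%N then F (- l.+1%:Z) else 0))).
  apply: eq_bigr => l _.
  rewrite [X in F l%:Z * X]big_mkcond [X in F (- l.+1%:Z) * X]big_mkcond.
  rewrite !mulr_sumr -big_split; apply: eq_bigr => k _ /=.
  by do 2 case: ifP => _; ring.
rewrite exchange_big; apply: eq_bigr => k _ /=.
rewrite -mulr_sumr sum_centered big_split /=; congr (_ * _).
rewrite -!big_mkcond /= /symsum big_split /= -addrA addrC.
have kM := ltn_ord k.
rewrite -(big_ord_widen M (fun l => F (- l.+1%:Z)) (ltnW kM)).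
rewrite -(big_ord_widen M (fun l => F l%:Z) kM) big_ord_recr /=.
ring.
Qed.

End SymmetricSums.

(** * Dirichlet energy and the Nash-Williams estimate *)

Definition walk_avg (R : realFieldType) (p : int -> R) (f : int * int -> R)
    (x : int * int) : R :=
  (2^-1 - p x.2) * (f (x.1 + 1, x.2) + f (x.1 - 1, x.2)) +
  p x.2 * (f (x.1, x.2 + 1) + f (x.1, x.2 - 1)).

Section Network.
Variables (R : realFieldType) (p : int -> R).
Hypothesis p_bounds : forall j : int, 0 < p j <= 2^-1.
Implicit Types (f phi : int * int -> R) (h : nat -> R) (M k : nat).

(* Conductance of the horizontal edges of row [j]; vertical edges have
   conductance 1. *)
Let cond j : R := (2^-1 - p j) / p j.

Let cond_ge0 j : 0 <= cond j.
Proof. by have /andP[p0 p1] := p_bounds j; rewrite divr_ge0 ?subr_ge0 // ltW. Qed.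

Let cond_total j : 2 * cond j + 2 = (p j)^-1.
Proof. by have /andP[p0 p1] := p_bounds j; rewrite /cond; field; rewrite gt_eqF. Qed.

(** Each point of the half-open box owns the edge to its right and the edge above it, so no edge is
    counted twice. *)
Definition dirichlet_energy M phi : R :=
  symsum M (fun i => symsum M (fun j =>
    cond j * (phi (i + 1, j) - phi (i, j)) ^+ 2
    + (phi (i, j + 1) - phi (i, j)) ^+ 2)).

(** Applied to one edge, with [a], [b] the values of f and [s], [t] those of phi at its ends; the
    gap is (1 - ab)(t - s)^2. *)
Lemma edge_energy_le (a b s t : R) : 0 <= a <= 1 -> 0 <= b <= 1 ->
  (t * b - s * a) ^+ 2 <= (b - a) * (t ^+ 2 * b - s ^+ 2 * a) + (t - s) ^+ 2.
Proof.
move=> /andP[a0 a1] /andP[b0 b1]; rewrite -subr_ge0.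
have -> : (b - a) * (t ^+ 2 * b - s ^+ 2 * a) + (t - s) ^+ 2 -
  (t * b - s * a) ^+ 2 = (1 - a * b) * (t - s) ^+ 2 by ring.
by rewrite mulr_ge0 ?sqr_ge0 // subr_ge0 mulr_ile1.
Qed.

Lemma energy_mul_harmonic_le M f phi :
  (forall x, 0 <= f x <= 1) -> f (0, 0) = 0 ->
  (forall x, x != (0, 0) -> walk_avg p f x = f x) ->
  (forall i j, (`|i| = M)%N \/ (`|j| = M)%N -> phi (i, j) = 0) ->
  dirichlet_energy M (fun x => phi x * f x) <= dirichlet_energy M phi.
Proof.
move=> f01 f0 fharm phi0.
pose v x := phi x ^+ 2 * f x.
pose edge i j := cond j * ((f (i + 1, j) - f (i, j)) * (v (i + 1, j) - v (i, j)))
  + (f (i, j + 1) - f (i, j)) * (v (i, j + 1) - v (i, j)).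
have v0 i j : (`|i| = M)%N \/ (`|j| = M)%N -> v (i, j) = 0.
  by move=> ij; rewrite /v phi0 // expr0n mul0r.
(* [edge] sums to the energy form of f against phi^2 f; summation by parts in both directions moves
   it to the Laplacian of f. *)
have edge0 : symsum M (fun i => symsum M (edge i)) = 0.
  transitivity (symsum M (fun i => symsum M (fun j =>
      cond j * (v (i, j) * (2 * f (i, j) - f (i + 1, j) - f (i - 1, j)))
      + v (i, j) * (2 * f (i, j) - f (i, j + 1) - f (i, j - 1))))).
    under [RHS]eq_symsum do rewrite symsumD.
    under [LHS]eq_symsum do rewrite symsumD.
    rewrite !symsumD; congr (_ + _).
      rewrite exchange_symsum [RHS]exchange_symsum; apply: eq_symsum => j.
      rewrite !symsumZ; congr (_ * _).
      rewrite (@symsum_by_parts _ M (fun i => f (i, j)) (fun i => v (i, j))) //.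
        by apply: v0; left; lia.
      by apply: v0; left; lia.
    apply: eq_symsum => i.
    rewrite (@symsum_by_parts _ M (fun j => f (i, j)) (fun j => v (i, j))) //.
      by apply: v0; right; lia.
    by apply: v0; right; lia.
  apply: symsum_eq0 => i; apply: symsum_eq0 => j.
  have /andP[p0 _] := p_bounds j.
  (* The network Laplacian at (i, j) is (f - [walk_avg p f]) / p_j; it vanishes off the origin, and
     at the origin the factor [v] does. *)
  transitivity (v (i, j) / p j * (f (i, j) - walk_avg p f (i, j))).
    by rewrite /walk_avg /cond /=; field; rewrite gt_eqF.
  have [ij0|/fharm ->] := eqVneq (i, j) (0, 0); last by rewrite subrr mulr0.
  by rewrite /v ij0 f0 mulr0 !mul0r.
rewrite -[leRHS]add0r -edge0 -symsumD; apply: ler_symsum => i.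
rewrite -symsumD; apply: ler_symsum => j.
rewrite /edge addrACA; apply: lerD; last exact: edge_energy_le.
by rewrite -mulrDr ler_wpM2l // edge_energy_le.
Qed.

Definition cut_conductance k : R := \sum_(i < k.*2.+1) (p (i%:Z - k%:Z))^-1.

(** Each |j| <= k contributes to the cut between radii k and k + 1 two edges of row j and two of
    column j, of conductance 2 [cond j] + 2 = 1 / p_j. *)
Lemma dirichlet_energy_radial M h :
  dirichlet_energy M (fun x => h (maxn `|x.1| `|x.2|)) =
  \sum_(k < M) (h k - h k.+1) ^+ 2 * cut_conductance k.
Proof.
rewrite /cut_conductance.
rewrite -(symsum_layers M (fun j => (p j)^-1) (fun k => (h k - h k.+1) ^+ 2)).
rewrite /dirichlet_energy /=.
under [LHS]eq_symsum do rewrite symsumD.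
(* The exchange pairs the horizontal edges of row j with the vertical edges of column j. *)
rewrite symsumD exchange_symsum -symsumD; apply: eq_symsum => j.
rewrite symsumZ symsum_radial_increment.
under eq_symsum do rewrite ![maxn `|j| _]maxnC.
by rewrite symsum_radial_increment -cond_total; ring.
Qed.

Lemma cut_conductance_gt0 k : 0 < cut_conductance k.
Proof.
have pV0 j : 0 < (p j)^-1 by have /andP[p0 _] := p_bounds j; rewrite invr_gt0.
by rewrite /cut_conductance big_ord_recl ltr_pwDl // sumr_ge0 // => i _; rewrite ltW.
Qed.

Let S M : R := \sum_(k < M) (cut_conductance k)^-1.

(** The test function is the radial voltage, of energy 1 / [S M]; the lower bound on [S M] keeps it
    at least 1/2 at radius 1, whence the constant 4. *)
Lemma network_potential_drop M f :
  (forall x, 0 <= f x <= 1) -> f (0, 0) = 0 ->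
  (forall x, x != (0, 0) -> walk_avg p f x = f x) ->
  2 * (cut_conductance 0)^-1 <= S M ->
  [/\ cond 0 * f (1, 0) ^+ 2 <= 4 / S M, cond 0 * f (-1, 0) ^+ 2 <= 4 / S M,
      f (0, 1) ^+ 2 <= 4 / S M & f (0, -1) ^+ 2 <= 4 / S M].
Proof.
move=> f01 f0 fharm SM.
pose r k := (cut_conductance k)^-1.
have r0 k : 0 < r k by rewrite invr_gt0 cut_conductance_gt0.
have S0 : 0 < S M by apply: lt_le_trans SM; rewrite mulr_gt0 // r0.
have M0 : (0 < M)%N by case: (M) S0 => //; rewrite /S big_ord0 ltxx.
have [I0 I1] : - M%:Z <= 0 < M%:Z /\ - M%:Z <= -1 < M%:Z.
  by clear -M0; split; lia.
(* The voltage on the sphere of radius [k] once every sphere is shorted. *)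
pose h k := (\sum_(l < M | (k <= l)%N) r l) / S M.
have hM k : (M <= k)%N -> h k = 0.
  move=> Mk; rewrite /h big_pred0 ?mul0r // => l.
  by apply/negbTE; rewrite -ltnNge (leq_trans (ltn_ord l)).
have hS (k : 'I_M) : h k - h k.+1 = r k / S M.
  rewrite /h -mulrBl (bigD1 k) //=.
  rewrite [X in _ - X](eq_bigl (fun l : 'I_M => (k <= l)%N && (l != k))) ?addrK //.
  by move=> l; rewrite ltn_neqAle eq_sym andbC.
have h0 : h 0%N = 1 by rewrite /h divff // gt_eqF.
have h1 : 2^-1 <= h 1%N.
  have := hS (Ordinal M0); rewrite /= h0 => h1E.
  have : r 0%N / S M <= 2^-1 by rewrite ler_pdivrMr // -ler_pdivrMl // invrK.
  lra.
pose phi (x : int * int) := h (maxn `|x.1| `|x.2|).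
have energy : dirichlet_energy M (fun x => phi x * f x) <= (S M)^-1.
  apply: le_trans (energy_mul_harmonic_le _ _ _ _) _ => // [i j ij|].
    by apply: hM => /=; case: ij => ->; rewrite ?leq_maxl ?leq_maxr.
  rewrite dirichlet_energy_radial.
  (* A drop r_k / [S M] across a cut of resistance r_k costs r_k / ([S M])^2, and these costs sum to
     1 / [S M]. *)
  rewrite (eq_bigr (fun k : 'I_M => r k / S M ^+ 2)) => [|k _].
    by rewrite -mulr_suml -/(S M) expr2 invfM mulrA divff ?mul1r // gt_eqF.
  rewrite hS /r; field.
  by rewrite !gt_eqF //= cut_conductance_gt0.
have edges i j : (- M%:Z <= i < M%:Z) -> (- M%:Z <= j < M%:Z) ->
    cond j * (phi (i + 1, j) * f (i + 1, j) - phi (i, j) * f (i, j)) ^+ 2 <= (S M)^-1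
    /\ (phi (i, j + 1) * f (i, j + 1) - phi (i, j) * f (i, j)) ^+ 2 <= (S M)^-1.
  move=> iM jM; set a := (X in X <= _ /\ _); set b := (X in _ /\ X <= _).
  have a0 : 0 <= a by apply: mulr_ge0; rewrite ?cond_ge0 ?sqr_ge0.
  have b0 : 0 <= b by exact: sqr_ge0.
  suff abS : a + b <= (S M)^-1.
    by split; apply: le_trans abS; rewrite ?lerDl ?lerDr.
  apply: le_trans energy; rewrite {a0 b0}/a /b.
  pose g x := phi x * f x.
  pose E i' j' := cond j' * (g (i' + 1, j') - g (i', j')) ^+ 2
    + (g (i', j' + 1) - g (i', j')) ^+ 2.
  have E0 i' j' : 0 <= E i' j'.
    by apply: addr_ge0; [apply: mulr_ge0|]; rewrite ?cond_ge0 ?sqr_ge0.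
  apply: le_trans (ler_symsum_term (F := fun i => symsum M (E i)) _ iM).
    exact: (ler_symsum_term (F := E i)).
  by move=> i'; apply: symsum_ge0.
have bound (c t a : R) : 0 <= c -> t = h 1%N -> c * (t * a) ^+ 2 <= (S M)^-1 ->
    c * a ^+ 2 <= 4 / S M.
  move=> c0 -> H; apply: le_trans (ler_wpM2l (ler0n _ 4) H).
  have -> : 4 * (c * (h 1%N * a) ^+ 2) = c * a ^+ 2 * (2 * h 1%N) ^+ 2 by ring.
  apply: ler_peMr; first by apply: mulr_ge0; rewrite ?sqr_ge0.
  apply: exprn_ege1; lra.
have c0 := cond_ge0 0.
(* Edges are stored at their left or lower end, so those towards (-1, 0) and (0, -1) are read
   there. *)
have [] := edges 0 0 I0 I0; rewrite !add0r f0 mulr0 !subr0 => H1 H2.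
have [] := edges (-1) 0 I1 I0; rewrite !addNr f0 mulr0 !sub0r sqrrN => H3 _.
have [] := edges 0 (-1) I0 I1; rewrite !addNr f0 mulr0 !sub0r sqrrN => _ H4.
split.
- by apply: bound H1.
- by apply: bound H3.
- rewrite -[_ ^+ 2]mul1r; apply: bound; rewrite ?mul1r; [exact: ler01|by []|].
  exact: H2.
- rewrite -[_ ^+ 2]mul1r; apply: bound; rewrite ?mul1r; [exact: ler01|by []|].
  exact: H4.
Qed.

Lemma walk_avg_eq0 f :
  (forall x, 0 <= f x <= 1) -> f (0, 0) = 0 ->
  (forall x, x != (0, 0) -> walk_avg p f x = f x) ->
  (forall B, exists M, B <= S M) ->
  walk_avg p f (0, 0) = 0.
Proof.
move=> f01 f0 fharm Sinfty.
have small (x : R) : 0 <= x -> (forall M, 2 * (cut_conductance 0)^-1 <= S M ->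
    x <= 4 / S M) -> x = 0.
  move=> x0 xS; apply/eqP; rewrite eq_le x0 andbT leNgt; apply/negP => xpos.
  (* The first summand meets the hypothesis of [network_potential_drop], and 5 / x forces 4 / [S M]
     < x. *)
  have [M SM] := Sinfty (2 * (cut_conductance 0)^-1 + 5 / x).
  have k0 : 0 < 2 * (cut_conductance 0)^-1.
    by rewrite mulr_gt0 // invr_gt0 cut_conductance_gt0.
  have x5 : 0 < 5 / x by rewrite divr_gt0.
  have Sx : 5 / x <= S M by apply: le_trans SM; rewrite lerDr ltW.
  have Sr : 2 * (cut_conductance 0)^-1 <= S M.
    by apply: le_trans SM; rewrite lerDl ltW.
  have := xS M Sr; rewrite leNgt => /negP; apply.
  rewrite ltr_pdivrMr ?(lt_le_trans k0 Sr) // -ltr_pdivrMl // mulrC.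
  by apply: lt_le_trans Sx; rewrite ltr_pM2r ?invr_gt0 // ltr_nat.
have drop := network_potential_drop f01 f0 fharm.
have c0 := cond_ge0 0.
have e1 : cond 0 * f (1, 0) ^+ 2 = 0.
  by apply: small => [|M /drop[]//]; rewrite mulr_ge0 ?sqr_ge0.
have e2 : cond 0 * f (-1, 0) ^+ 2 = 0.
  by apply: small => [|M /drop[]//]; rewrite mulr_ge0 ?sqr_ge0.
have /eqP : f (0, 1) ^+ 2 = 0 by apply: small => [|M /drop[]//]; rewrite sqr_ge0.
have /eqP : f (0, -1) ^+ 2 = 0 by apply: small => [|M /drop[]//]; rewrite sqr_ge0.
rewrite !sqrf_eq0 => /eqP e4 /eqP e3.
(* If p_0 = 1/2, then [cond 0] = 0 and f is not controlled at the horizontal neighbours, but their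
   weight in the average is zero as well. *)
have cf (a : R) : cond 0 * a ^+ 2 = 0 -> (2^-1 - p 0) * a = 0.
  have /andP[p0 _] := p_bounds 0.
  move=> /eqP; rewrite /cond !mulf_eq0 invr_eq0 (gt_eqF p0) orbF orbb.
  by case/orP => /eqP ->; rewrite ?mul0r ?mulr0.
by rewrite /walk_avg /= !add0r e3 e4 mulrDr !cf // !addr0 mulr0 addr0.
Qed.

End Network.

(* The probability that the walk started at [x] avoids the origin at all times
   [0, ..., n]. *)
Fixpoint survival (R : realFieldType) (p : int -> R) (n : nat) (x : int * int)
    : R :=
  if n is n'.+1 then (x != (0, 0))%:R * walk_avg p (survival p n') x
  else (x != (0, 0))%:R.

(** * Survival probabilities and their limit *)

Section Survival.
Import numFieldNormedType.Exports.
Variables (R : realType) (p : int -> R).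
Hypothesis p_bounds : forall j : int, 0 < p j <= 2^-1.
Implicit Types (f g : int * int -> R).

Let pge0 j : 0 <= p j. Proof. by have /andP[/ltW] := p_bounds j. Qed.
Let qge0 j : 0 <= 2^-1 - p j.
Proof. by have /andP[_] := p_bounds j; rewrite subr_ge0. Qed.

Lemma ler_walk_avg f g x :
  (forall y, f y <= g y) -> walk_avg p f x <= walk_avg p g x.
Proof. by move=> fg; apply: lerD; rewrite ler_wpM2l ?lerD. Qed.

Lemma walk_avg_cst a x : walk_avg p (fun=> a) x = a.
Proof. by rewrite /walk_avg; field. Qed.

Lemma walk_avg_ge0 f x : (forall y, 0 <= f y) -> 0 <= walk_avg p f x.
Proof. by move=> /ler_walk_avg; rewrite -{2}(walk_avg_cst 0 x); exact. Qed.

Lemma survival_ge0 n x : 0 <= survival p n x.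
Proof.
elim: n x => [|n IH] x /=; first by rewrite ler0n.
by rewrite mulr_ge0 ?ler0n ?walk_avg_ge0.
Qed.

Lemma survivalS_le n x : survival p n.+1 x <= survival p n x.
Proof.
elim: n x => [|n IH] x.
  rewrite /= ler_piMr ?ler0n // -[leRHS](walk_avg_cst 1 x).
  by apply: ler_walk_avg => y; case: eqP.
by rewrite [leLHS]/= [leRHS]/= ler_wpM2l ?ler0n ?ler_walk_avg.
Qed.

Let f x : R := inf (range (survival p ^~ x)).

Let cvg_f x : survival p n x @[n --> \oo] --> f x.
Proof.
apply: nonincreasing_cvgn; last by exists 0 => _ [n _ <-]; exact: survival_ge0.
by apply/nonincreasing_seqP => n; exact: survivalS_le.
Qed.

Let cvg_walk_avg x : walk_avg p (survival p n) x @[n --> \oo] --> walk_avg p f x.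
Proof. by apply: cvgD; apply: cvgM; (exact: cvg_cst || exact: cvgD). Qed.

(** Passing to the limit in the recursion for [survival] makes [f] vanish at the origin and harmonic
    elsewhere. *)
Let fE x : f x = (x != (0, 0))%:R * walk_avg p f x.
Proof.
have H : survival p n.+1 x @[n --> \oo] --> (x != (0, 0))%:R * walk_avg p f x.
  by apply: cvgM => //; exact: cvg_cst.
have H2 : survival p n.+1 x @[n --> \oo] --> f x.
  by rewrite (cvg_shiftS (survival p ^~ x)).
by apply: cvg_unique H2 H.
Qed.

Let f_bounds x : 0 <= f x <= 1.
Proof.
apply/andP; split.
  by apply: cvgr_to_ge (@cvg_f x) _; apply: nearW => n; exact: survival_ge0.
apply: cvgr_to_le (@cvg_f x) _; apply: nearW.
elim=> [|n IH]; first by rewrite /=; case: eqP.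
exact: le_trans (survivalS_le n x) IH.
Qed.

(** The sequence is the probability that the walk from the origin avoids it at times 1 to n + 1; its
    limit is the average of [f] at the origin. *)
Lemma cvg_escape :
  (\sum_(0 <= k <oo) ((cut_conductance p k)^-1)%:E = +oo)%E ->
  walk_avg p (survival p n) (0, 0) @[n --> \oo] --> 0.
Proof.
move=> div.
suff <- : walk_avg p f (0, 0) = 0 by exact: cvg_walk_avg.
apply: walk_avg_eq0 => //.
- by rewrite fE eqxx mul0r.
- by move=> x x0; rewrite [RHS]fE x0 mul1r.
move=> B.
have : (\sum_(0 <= k < n) ((cut_conductance p k)^-1)%:E)%E @[n --> \oo] --> +oo%E.
  rewrite -div; apply: is_cvg_nneseries => k _ _.
  by rewrite lee_fin invr_ge0 ltW // cut_conductance_gt0.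
move=> /cvgeyPge /(_ B) [M _ /(_ M (leqnn M))] /= BM.
exists M; rewrite -lee_fin -sumEFin.
by rewrite -(big_mkord xpredT (fun k => ((cut_conductance p k)^-1)%:E)).
Qed.

End Survival.

(** * The Markov property along trajectories *)

Lemma measurable_int2 (A : set (int * int)) : measurable A.
Proof.
apply: countable_measurable; last exact: countableP.
move=> [a b].
have -> : [set (a, b)] = [set a] `*` [set b].
  by apply/seteqP; split => [_ ->|[x y] /= [-> ->]].
exact: measurableX.
Qed.

Section Walk.
Import numFieldNormedType.Exports.
Variables (R : realType) (p : int -> R).
Hypothesis p_bounds : forall j : int, 0 < p j <= 2^-1.
Variables (d : measure_display) (T : measurableType d) (P : probability T R).
Variable C : nat -> {RV P >-> (int * int)%type}.
Hypothesis C_walk : anisotropic_walk p C.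
Implicit Types (N m : nat) (x : nat -> int * int) (y : int * int) (A B : set T).

Let mu A : R := fine (P A).

Let muE A : measurable A -> P A = (mu A)%:E.
Proof. by move=> mA; rewrite fineK // fin_num_measure. Qed.

Let mu_ge0 A : 0 <= mu A. Proof. exact: fine_ge0. Qed.

Let le_mu A B : measurable A -> measurable B -> A `<=` B -> mu A <= mu B.
Proof. by move=> mA mB AB; rewrite -lee_fin -!muE // le_measure ?inE. Qed.

Let muDI A B : measurable A -> measurable B -> mu A = mu (A `\` B) + mu (A `&` B).
Proof.
move=> mA mB; apply: EFin_inj.
rewrite EFinD -!muE ?(measureDI P mA mB) //; first exact: measurableI.
exact: measurableD.
Qed.

Let measurable_event N (Q : set (int * int)) : measurable [set w | Q (C N w)].
Proof. exact: measurable_funPTI (measurable_int2 Q). Qed.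

(** Splitting over a finite list of positions with one remainder term avoids countable sums. *)
Let mu_split N B (s : seq (int * int)) : uniq s -> measurable B ->
  mu B = mu (B `&` [set w | C N w \notin s]) +
         \sum_(y <- s) mu (B `&` [set w | C N w = y]).
Proof.
move=> + mB; elim: s => [|y s IH] /=.
  by rewrite big_nil addr0 (_ : [set _ | _] = setT) ?setIT //; apply/seteqP.
move=> /andP[ys us]; rewrite big_cons addrA IH //; congr (_ + _).
have mE := measurable_event N (fun z => z \notin s).
rewrite (muDI (measurableI _ _ mB mE) (measurable_event N (eq^~ y))) /=.
congr (mu _ + mu _).
  apply/seteqP; split => w /=.
    by move=> [[Bw ws] wy]; split; rewrite // inE negb_or ws andbT; apply/eqP.
  by rewrite inE negb_or => -[Bw /andP[/eqP wy ws]].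
apply/seteqP; split => w /=; first by case=> -[].
by move=> [Bw wy]; do ![split]; rewrite // wy.
Qed.

Let past x N : set T := [set w | forall n, (n <= N)%N -> C n w = x n].

Let measurable_past x N : measurable (past x N).
Proof.
rewrite (_ : past x N = \bigcap_(n in [set n | (n <= N)%N]) [set w | C n w = x n]).
  apply: bigcap_measurable => [|n _]; first by exists 0%N.
  exact: (measurable_event n (eq^~ (x n))).
by apply/seteqP; split.
Qed.

Let neighbours y : seq (int * int) :=
  [:: (y.1 + 1, y.2); (y.1 - 1, y.2); (y.1, y.2 + 1); (y.1, y.2 - 1)].

Let uniq_neighbours y : uniq (neighbours y).
Proof.
by case: y => a b; rewrite /= !inE !xpair_eqE; lia.
Qed.

(** The Markov property turns conditioning on the position at time [N] into conditioning on the
    whole past. *)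
Let step_prob N x (c : R) y :
  P (past x N) != 0%E ->
  cond_prob P [set w | C N.+1 w = y] [set w | C N w = x N] = c ->
  mu (past x N `&` [set w | C N.+1 w = y]) = c * mu (past x N).
Proof.
move=> past0 <-; rewrite -(C_walk.1 N x y past0) /cond_prob setIC divfK //.
by apply: contra past0 => /eqP past0; rewrite muE // /mu past0.
Qed.

(** If [g] bounds the conditional probability of [A] after each one-step extension of the past, the
    average of [g] over the next position bounds it before the step. *)
Let one_step N x A (g : int * int -> R) : measurable A ->
  (forall x', (forall n, (n <= N)%N -> x' n = x n) ->
    mu (past x' N.+1 `&` A) <= g (x' N.+1) * mu (past x' N.+1)) ->
  mu (past x N `&` A) <= walk_avg p g (x N) * mu (past x N).
Proof.
move=> mA gA.
have mP := measurable_past x N.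
have mPA := measurableI _ _ mP mA.
have [past0|past0] := eqVneq (P (past x N)) 0%E.
  rewrite {2}/mu past0 mulr0.
  have <- : mu (past x N) = 0 by rewrite /mu past0.
  by apply: le_mu => //; exact: subIsetl.
have CN0 : P [set w | C N w = x N] != 0%E.
  apply: contra past0; rewrite -!measure_le0; apply: le_trans.
  apply: le_measure; rewrite ?inE //; first exact: (measurable_event N (eq^~ (x N))).
  by move=> w /=; exact.
have := C_walk.2 N (x N).1 (x N).2; rewrite -surjective_pairing /=.
move=> /(_ CN0) [/(step_prob past0) s1 /(step_prob past0) s2
  /(step_prob past0) s3 /(step_prob past0) s4].
(* The four transition probabilities sum to 1, so no mass is left for other positions. *)
have rest0 : mu (past x N `&` [set w | C N.+1 w \notin neighbours (x N)]) = 0.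
  have := mu_split N.+1 (uniq_neighbours (x N)) mP.
  rewrite !big_cons big_nil s1 s2 s3 s4; set b := mu (past x N); lra.
have bound y : mu (past x N `&` A `&` [set w | C N.+1 w = y]) <=
    g y * mu (past x N `&` [set w | C N.+1 w = y]).
  pose x' n := if (n <= N)%N then x n else y.
  have x'E : past x N `&` [set w | C N.+1 w = y] = past x' N.+1.
    apply/seteqP; split => w /=.
      move=> [pw wy] n; rewrite /x' leq_eqVlt ltnS => /orP[/eqP ->|nN].
        by rewrite ltnn.
      by rewrite nN pw.
    move=> pw; split => [n nN|]; first by rewrite pw ?leqW // /x' nN.
    by rewrite pw // /x' ltnn.
  rewrite setIAC x'E; have := gA x'.
  rewrite (_ : x' N.+1 = y); last by rewrite /x' ltnn.
  apply.
  by move=> n; rewrite /x' => ->.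
rewrite (mu_split N.+1 (uniq_neighbours (x N)) mPA) !big_cons big_nil addr0.
rewrite (_ : mu _ = 0) ?add0r; last first.
  apply/eqP; rewrite eq_le mu_ge0 andbT -rest0; apply: le_mu.
  - by apply: measurableI => //; exact: (measurable_event _ (fun z => z \notin _)).
  - by apply: measurableI => //; exact: (measurable_event _ (fun z => z \notin _)).
  - by move=> w [[]].
apply: le_trans (lerD (bound _) (lerD (bound _) (lerD (bound _) (bound _)))) _.
by rewrite s1 s2 s3 s4 /walk_avg le_eqVlt; apply/orP; left; apply/eqP; ring.
Qed.

(** * Avoiding the origin, last visits and recurrence *)

Let avoid N m : set T := [set w | forall n, (N <= n <= N + m)%N -> C n w != (0, 0)].

Let measurable_avoid N m : measurable (avoid N m).
Proof.
rewrite (_ : avoid N m =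
    \bigcap_(n in [set n | (N <= n <= N + m)%N]) [set w | C n w != (0, 0)]).
  apply: bigcap_measurable => [|n _]; first by exists N; rewrite /= leqnn leq_addr.
  exact: (measurable_event n (fun z => z != (0, 0))).
by apply/seteqP; split.
Qed.

(** Induction on [m] over all times and trajectories: [one_step] reproduces the recursion that
    defines [survival]. *)
Let mu_avoid N m x :
  mu (past x N `&` avoid N m) <= survival p m (x N) * mu (past x N).
Proof.
have mPA N' m' x' := measurableI _ _
  (measurable_past x' N') (measurable_avoid N' m').
elim: m N x => [|m IH] N x; have [x0|xN0] := eqVneq (x N) (0, 0).
- rewrite (_ : _ `&` _ = set0); first by rewrite /mu measure0 /= x0 eqxx mul0r.
  apply/seteqP; split => // w [pw /(_ N)].
  by rewrite leqnn leq_addr pw // x0 => /(_ isT).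
- by rewrite /= xN0 mul1r; apply: le_mu => //; exact: subIsetl.
- rewrite (_ : _ `&` _ = set0); first by rewrite /mu measure0 /= x0 eqxx !mul0r.
  apply/seteqP; split => // w [pw /(_ N)].
  by rewrite leqnn leq_addr pw // x0 => /(_ isT).
rewrite /= xN0 mul1r.
apply: (@le_trans _ _ (mu (past x N `&` avoid N.+1 m))).
  apply: le_mu => // [|w [pw aw]]; first exact: measurableI.
  by split => // n /andP[Nn nm]; apply: aw; rewrite (ltnW Nn) addnS.
by apply: one_step => // x' _; exact: IH.
Qed.

Hypothesis escape : walk_avg p (survival p n) (0, 0) @[n --> \oo] --> (0 : R).

(** For every [m] the event lies in [avoid N.+1 m], so its probability is at most the escape term
    times that of the past, which tends to 0. *)
Let last_visit_negligible N x : x N = (0, 0) ->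
  P.-negligible (past x N `&` [set w | forall n, (N < n)%N -> C n w != (0, 0)]).
Proof.
move=> xN.
pose E := past x N `&` [set w | forall n, (N < n)%N -> C n w != (0, 0)].
have mE : measurable E.
  apply: measurableI => //.
  rewrite (_ : [set _ | _] =
      \bigcap_(n in [set n | (N < n)%N]) [set w | C n w != (0, 0)]).
    apply: bigcap_measurable => [|n _]; first by exists N.+1 => /=.
    exact: (measurable_event n (fun z => z != (0, 0))).
  by apply/seteqP; split.
apply/(negligibleP _ mE); apply: etrans (muE mE) _; congr (_%:E).
apply/eqP; rewrite eq_le mu_ge0 andbT.
have bound m : mu E <= walk_avg p (survival p m) (0, 0) * mu (past x N).
  apply: (@le_trans _ _ (mu (past x N `&` avoid N.+1 m))).
    apply: le_mu => // [|w [pw aw]]; first exact: measurableI.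
    by split => // n /andP[Nn nm]; exact: aw.
  by rewrite -xN; apply: one_step => // x' _; exact: mu_avoid.
have lim0 :
    walk_avg p (survival p m) (0, 0) * mu (past x N) @[m --> \oo] --> (0 : R).
  rewrite -[X in _ --> X](mul0r (mu (past x N))).
  by apply: cvgM => //; exact: cvg_cst.
by apply: cvgr_to_ge lim0 _; apply: nearW.
Qed.

Hypothesis C_start : P [set w | C 0%N w = (0, 0)] = 1%E.

Lemma recurrent_of_escape : recurrent C.
Proof.
pose visit N := [set w | C N w = (0, 0)].
have mvisit N : measurable (visit N) by exact: (measurable_event N (eq^~ (0, 0))).
(* The default lies off the origin, so the empty trajectory gets the empty event. *)
pose x_ (s : seq (int * int)) n := nth (1, 1) s n.
pose last_visit s := if x_ s (size s).-1 == (0, 0) then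
  past (x_ s) (size s).-1 `&`
    [set w | forall n, ((size s).-1 < n)%N -> C n w != (0, 0)] else set0.
have last0 s : P.-negligible (last_visit s).
  rewrite /last_visit; case: eqP => [/last_visit_negligible //|_].
  exact: negligible_set0.
have start0 : P.-negligible (~` visit 0%N).
  apply/(negligibleP _ (measurableC (mvisit 0%N))).
  by apply: etrans (probability_setC P (mvisit 0%N)) _; rewrite C_start subee.
(* Pickling enumerates the finite trajectories, so the exceptional events form a countable union. *)
pose bad k := if @unpickle (seq (int * int)) k is Some s then last_visit s else set0.
have badE s : bad (pickle s) = last_visit s by rewrite /bad pickleK.
have bad0 : P.-negligible (\bigcup_k bad k).
  apply: negligible_bigcup => k; rewrite /bad.
  by case: unpickle => // ; exact: negligible_set0.
have mlim : measurable (lim_sup_set visit).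
  by apply: bigcapT_measurable => n; apply: bigcup_measurable.
suff : P (~` lim_sup_set visit) = 0%E.
  rewrite probability_setC // /recurrent -/visit muE // -EFinB => -[/eqP].
  by rewrite subr_eq0 => /eqP <-.
apply/(negligibleP _ (measurableC mlim)).
apply: negligibleS (negligibleU start0 bad0) => w nlim.
have [w0|/= w0] := pselect (visit 0%N w); [right|by left].
(* Outside the limit superior the visits stop; as there is one at time 0, there is a last one. *)
have [K noK] : exists K, forall n, (K <= n)%N -> C n w != (0, 0).
  apply: contrapT => H; apply: nlim => n _.
  apply: contrapT => Hn; apply: H; exists n => m nm; apply/eqP => wm.
  by apply: Hn; exists m.
have exv : exists n, C n w == (0, 0) by exists 0%N; apply/eqP.
have ubv n : C n w == (0, 0) -> (n <= K)%N.
  by apply: contraTT; rewrite -ltnNge => /ltnW; exact: noK.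
have [N /eqP wN maxN] := ex_maxnP exv ubv.
(* The trajectory up to the last visit indexes the bad event that contains [w]. *)
pose s := [seq C n w | n <- iota 0 N.+1].
have sE : (size s).-1 = N by rewrite size_map size_iota.
have xE n : (n <= N)%N -> x_ s n = C n w.
  by move=> nN; rewrite /x_ (nth_map 0%N) ?size_iota // nth_iota.
exists (pickle s); first exact: I.
rewrite badE /last_visit sE xE // wN eqxx.
split => n /= Nn; first by rewrite xE.
by apply/negP => /maxN; rewrite leqNgt Nn.
Qed.

End Walk.

Theorem theorem1p1 (R : realType) (p : int -> R)
    (p_bounds : forall j : int, 0 < p j <= 2^-1)
    (p_inf : inf (range p) < 2^-1)
    (d : measure_display) (T : measurableType d) (P : probability T R)
    (C : nat -> {RV P >-> (int * int)%type})
    (C_walk : anisotropic_walk p C)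
    (C_start : P [set w | C 0%N w = (0, 0)] = 1%E)
    (* index i stands for j = i - k, so that j runs from - k to k *)
    (sum_diverges :
      (\sum_(0 <= k <oo)
         ((\sum_(i < k.*2.+1) (p (i%:Z - k%:Z))^-1)^-1)%:E = +oo)%E) :
  recurrent C.
Proof. exact: recurrent_of_escape (cvg_escape p_bounds sum_diverges) C_start. Qed.
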